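(* Let $0<\alpha<1$ and let $u\in C^1(\mathbb{R})$ be a bounded solution of $$\partial_t^\alpha u(t)=0\quad\text{in }\mathbb{R}.$$ Then $u$ must be constant.
   Context: The Marchaud fractional derivative of order $\alpha\in(0,1)$ is $$\partial_t^\alpha u(t)=C_\alpha\int_{-\infty}^t\frac{u(t)-u(\tau)}{(t-\tau)^{1+\alpha}}\,d\tau,\qquad C_\alpha=\frac{\alpha}{\Gamma(1-\alpha)},$$ where $\Gamma$ is the Gamma function. The equation is understood pointwise for every $t\in\mathbb{R}$. *)

(* Defs.v *)
From mathcomp Require Import all_boot all_order all_algebra.
From mathcomp Require Import all_classical all_reals all_analysis.

Set Implicit Arguments.
Unset Strict Implicit.
Unset Printing Implicit Defensive.

Import Order.TTheory GRing.Theory Num.Theory.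
Import numFieldNormedType.Exports.

Local Open Scope classical_set_scope.
Local Open Scope ring_scope.

Definition Gamma {R : realType} (s : R) : R :=
  Rintegral lebesgue_measure `]0, +oo[ (fun x => x `^ (s - 1) * expR (- x)).

Definition marchaud_const {R : realType} (alpha : R) : R :=
  alpha / Gamma (1 - alpha).

(* The value is extended real, so that it can be a real number only if the
   integral converges absolutely (for measurable [u] and
   [marchaud_const alpha] nonzero): the library's integral is [+oo] or [-oo]
   when the positive or the negative part has infinite integral. *)
Definition marchaud {R : realType} (alpha : R) (u : R -> R) (t : R) : \bar R :=
  ((marchaud_const alpha)%:E *
   \int[lebesgue_measure]_(tau in `]-oo, t[)
     ((u t - u tau) / (t - tau) `^ (1 + alpha))%:E)%E.

(* [derive1] is total, so derivability has to be required separately. *)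
Definition C1 {R : realType} (u : R -> R) : Prop :=
  (forall t, derivable u t 1) /\ continuous (derive1 u).

(* Main.v *)
Require Import Defs.
From mathcomp Require Import all_boot all_order all_algebra.
From mathcomp Require Import all_classical all_reals all_analysis.
From mathcomp Require Import measurable_realfun ring lra.

Import Order.TTheory GRing.Theory Num.Theory.
Import numFieldNormedType.Exports.

Local Open Scope classical_set_scope.
Local Open Scope ring_scope.

(** A bounded function whose Marchaud derivative vanishes identically has
    oscillation zero, because the equation forces the oscillation to contract.

    Write [m] and [M] for the infimum and the supremum of [u]. The claim is
    that there is [c > 0], depending only on [alpha], such that
    [u x - u y <= (1 - c) * (M - m)] for all [x] and [y]
    ([marchaud_null_osc_decay]). Taking the supremum over [x] and the infimum
    over [y] gives [M - m <= (1 - c) * (M - m)], hence [M = m]. The constant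
    does not depend on the distance between [x] and [y] because the equation is
    invariant under translations and dilations.

    The contraction comes from a growth estimate ([marchaud_null_growth]). Let
    [v >= 0] be a solution whose mean over [[a - L, a]] is at least [D / 2].
    Then [c * D <= v] on [[a + L, a + 2 * L]]. To prove it, compare [v] with
    [h * ramp], where the ramp rises linearly from 0 at [a] to 1 at [a + L] and
    [h = c * D]. If [v < h] somewhere on [[a + L, a + 2 * L]], then
    [v - h * ramp] has a negative minimum over [[a, a + 2 * L]] at some [t0].
    Since the equation looks only at the past of [t0], and
    [v - h * ramp = v >= 0] before [a], this is a minimum over the whole past.
    Comparing the vanishing integral at [t0] with that of the ramp yields
    [(3 * L) `^ (- (1 + alpha)) * int_(a - L)^a v <= h * C * L `^ (- alpha)],
    with [C = alpha^-1 + (1 - alpha)^-1], which fails for [c] small. Of the two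
    solutions [u - m] and [M - u], whose sum is [M - m], at least one has mean
    at least [(M - m) / 2] over [[a - L, a]], and either case bounds
    [u x - u y].

    The integral in the Marchaud derivative can be separated from its
    normalizing factor because [0 < Gamma (1 - alpha) < +oo] ([Gamma_gt0]).
    Moreover, if the extended real integral of a measurable function is 0, the
    function is integrable ([integral_eq0_integrable]), which makes the
    comparison of integrals legitimate. *)

(** * Integrals of nonnegative derivatives *)

(** If [F' = f >= 0] on a set exhausted by the segments [[c n, d n]] and [F]
    takes its values in [[m, M]], then the integral of [f] is at most [M - m].
    Nothing is required at the ends of the set, where [f] may be unbounded, so
    the bound applies to improper integrals. *)
Lemma integral_le_primitive {R : realType} (f F : R -> R) (m M : R)
    (A : set R) (c d : nat -> R) :
  (forall n, c n < d n) ->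
  {homo c : n p / (n <= p)%N >-> p <= n} ->
  {homo d : n p / (n <= p)%N >-> n <= p} ->
  A = \bigcup_n `[c n, d n]%classic ->
  (forall x, A x -> 0 <= f x) ->
  (forall x, A x -> {for x, continuous f}) ->
  (forall x, A x -> is_derive x 1 F (f x)) ->
  (forall x, A x -> m <= F x <= M) ->
  (\int[lebesgue_measure]_(x in A) (f x)%:E <= (M - m)%:E)%E.
Proof.
move=> cd cni dnd AE f0 fc dF Fb.
pose I n : set R := `[c n, d n]%classic.
have IA n x : I n x -> A x by rewrite AE; exists n.
have ndI : nondecreasing_seq I.
  move=> n p np; rewrite subsetEset => x; rewrite /I /= !in_itv/= => /andP[h1 h2].
  by rewrite (le_trans (cni _ _ np))//= (le_trans h2)// dnd.
have wf n : {within I n, continuous f}.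
  by apply: continuous_in_subspaceT => x; rewrite inE => /IA; exact: fc.
have mf n : measurable_fun (I n) (fun x => (f x)%:E).
  apply/measurable_EFinP.
  exact: subspace_continuous_measurable_fun (measurable_itv _) (wf n).
have f0I n x : I n x -> (0 <= (f x)%:E)%E by move=> /IA h; rewrite lee_fin f0.
rewrite AE.
have cv := ge0_nondecreasing_set_cvg_integral (mu := lebesgue_measure) ndI
  (fun n => measurable_itv _) mf f0I.
rewrite -(cvg_lim _ cv)//; apply: lime_le; first by apply/cvg_ex; eexists; exact: cv.
apply: nearW => n.
have Ic : I n (c n) by rewrite /I /= in_itv/= lexx ltW.
have Id : I n (d n) by rewrite /I /= in_itv/= lexx ltW.
have cF x : I n x -> {for x, continuous F}.
  move=> /IA h; apply/differentiable_continuous/derivable1_diffP.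
  by have := dF _ h => -[].
rewrite (continuous_FTC2 (F := F) (cd n)).
- rewrite -EFinB lee_fin; have := Fb _ (IA _ _ Ic); have := Fb _ (IA _ _ Id); lra.
- exact: wf.
- split.
  + move=> x xI; have /IA h : I n x by apply: subset_itv_oo_cc; rewrite /=.
    by have [] := dF _ h.
  + by apply: cvg_at_right_filter; apply: cF.
  + by apply: cvg_at_left_filter; apply: cF.
- move=> x xI; have /IA h : I n x by apply: subset_itv_oo_cc; rewrite /=.
  by rewrite derive1E; have [] := dF _ h.
Qed.

Lemma integral_itvoo_le_primitive {R : realType} (f F : R -> R) (a b m M : R) :
  a < b ->
  (forall x, a < x < b -> 0 <= f x) ->
  (forall x, a < x < b -> {for x, continuous f}) ->
  (forall x, a < x < b -> is_derive x 1 F (f x)) ->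
  (forall x, a < x < b -> m <= F x <= M) ->
  (\int[lebesgue_measure]_(x in `]a, b[) (f x)%:E <= (M - m)%:E)%E.
Proof.
move=> ab f0 fc dF Fb.
pose e n : R := (b - a) / n.+3%:R.
have e0 n : 0 < e n by rewrite divr_gt0 ?subr_gt0.
have eni n p : (n <= p)%N -> e p <= e n.
  by move=> np; rewrite ler_pM2l ?subr_gt0// lef_pV2 ?posrE// ler_nat.
have Aab x : `]a, b[%classic x -> a < x < b by rewrite /= in_itv.
apply: (@integral_le_primitive R f F m M _ (fun n => a + e n)
    (fun n => b - e n) _ _ _ _
    (fun x h => f0 x (Aab x h)) (fun x h => fc x (Aab x h))
    (fun x h => dF x (Aab x h)) (fun x h => Fb x (Aab x h)))
    => [n|n p /eni|n p /eni|]; [|lra|lra|].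
- rewrite -subr_gt0 (_ : _ - _ = (b - a) * (1 - 2 / n.+3%:R)); last by rewrite /e; ring.
  by rewrite mulr_gt0 ?subr_gt0// ltr_pdivrMr// mul1r ltr_nat.
- apply/seteqP; split=> [x /Aab /andP[ax xb]|x [n _ /=]]; last first.
    by rewrite !in_itv/= => /andP[h1 h2]; have := e0 n => ?; apply/andP; split; lra.
  (* [e n] is below the distance from [x] to the ends as soon as
     [n > (b - a) / d]. *)
  pose d := Num.min (x - a) (b - x).
  have d0 : 0 < d by rewrite lt_min !subr_gt0 ax.
  pose n := Num.truncn ((b - a) / d).
  have en : e n < d.
    rewrite ltr_pdivrMr// mulrC -ltr_pdivrMr//.
    by apply: lt_le_trans (truncnS_gt _) _; rewrite ler_nat /n; exact: leqW.
  exists n => //; rewrite /= in_itv/=.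
  by move: en; rewrite lt_min => /andP[h1 h2]; apply/andP; split; lra.
Qed.

Lemma integral_itvNyo_le_primitive {R : realType} (f F : R -> R) (b m M : R) :
  (forall x, x < b -> 0 <= f x) ->
  (forall x, x < b -> {for x, continuous f}) ->
  (forall x, x < b -> is_derive x 1 F (f x)) ->
  (forall x, x < b -> m <= F x <= M) ->
  (\int[lebesgue_measure]_(x in `]-oo, b[) (f x)%:E <= (M - m)%:E)%E.
Proof.
move=> f0 fc dF Fb.
pose e n : R := n.+2%:R^-1.
have e1 n : 0 < e n < 1 by rewrite invr_gt0 ltr0n/= invf_lt1// ltr1n.
have Ab x : `]-oo, b[%classic x -> x < b by rewrite /= in_itv.
apply: (@integral_le_primitive R f F m M _ (fun n => b - n.+1%:R)
    (fun n => b - e n) _ _ _ _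
    (fun x h => f0 x (Ab x h)) (fun x h => fc x (Ab x h))
    (fun x h => dF x (Ab x h)) (fun x h => Fb x (Ab x h)))
    => [n|n p np|n p np|].
- by have /andP[_ h] := e1 n; rewrite ltrD2l ltrN2 (lt_le_trans h)// ler1n.
- by rewrite lerD2l lerN2 ler_nat.
- by rewrite lerD2l lerN2 lef_pV2 ?posrE// ler_nat.
- apply/seteqP; split=> [x /Ab xb|x [n _ /=]]; last first.
    by rewrite !in_itv/= => /andP[_ h]; have := e1 n => ?; lra.
  pose n := maxn (Num.truncn (b - x)) (Num.truncn (b - x)^-1).
  exists n => //; rewrite /= in_itv/=; apply/andP; split.
    rewrite lerBlDr -lerBlDl ltW//.
    by apply: lt_le_trans (truncnS_gt _) _; rewrite ler_nat ltnS leq_maxl.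
  rewrite lerBrDr -lerBrDl -[leRHS]invrK lef_pV2 ?posrE ?invr_gt0 ?subr_gt0// ltW//.
  apply: lt_le_trans (truncnS_gt _) _; rewrite ler_nat ltnS.
  by rewrite (leq_trans (leq_maxr _ _) (leqnSn _)).
Qed.

(** * Positivity and finiteness of the Gamma function on ]0, 1] *)

Lemma integral_expRN_1y {R : realType} :
  (\int[lebesgue_measure]_(x in `[1%R, +oo[) (expR (- x))%:E = (expR (-1 : R))%:E)%E.
Proof.
rewrite (@ge0_continuous_FTC2y _ _ (fun x : R => - expR (- x)) 1 0).
- by rewrite sub0e -EFinN opprK.
- by move=> x _; exact: expR_ge0.
- apply: continuous_in_subspaceT => x _.
  apply: (@continuous_comp _ _ _ -%R expR); first exact: opp_continuous.
  exact: continuous_expR.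
- rewrite -oppr0; apply: cvgN.
  exact: cvgr_expR.
- by move=> x _.
- apply: cvg_at_right_filter; apply: cvgN.
  apply: (@continuous_comp _ _ _ -%R expR); first exact: opp_continuous.
  exact: continuous_expR.
- move=> x _; rewrite derive1E derive_val.
  ring.
Qed.

Lemma measurable_Gamma_integrand {R : realType} (D : set R) (s : R) :
  measurable_fun D (fun x : R => (x `^ (s - 1) * expR (- x))%:E).
Proof.
apply/measurable_EFinP; apply: measurable_funTS.
apply: measurable_funM; first exact: measurable_powR.
by apply: measurableT_comp => //; exact: oppr_measurable.
Qed.

(** The integrand is at most [x `^ (s - 1)] on ]0, 1[ and at most [expR (- x)]
    on [1, +oo[; the second bound uses [s <= 1]. *)
Lemma Gamma_integral_lty {R : realType} (s : R) : 0 < s -> s <= 1 ->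
  (\int[lebesgue_measure]_(x in `]0%R, +oo[) (x `^ (s - 1) * expR (- x))%:E < +oo)%E.
Proof.
move=> s0 s1.
have mG D := measurable_Gamma_integrand D s.
rewrite (@itv_bndbnd_setU _ _ _ (BLeft 1)) ?bnd_simp//.
rewrite ge0_integral_setU//=; last 3 first.
- by apply: mG.
- by move=> x _; rewrite lee_fin mulr_ge0 ?powR_ge0 ?expR_ge0.
- rewrite disj_set2E; apply/eqP/seteqP; split=> // x [] /=.
  by rewrite !in_itv/= andbT => /andP[_ h1] h2; lra.
apply: lte_add_pinfty.
- apply: (@le_lt_trans _ _
    (\int[lebesgue_measure]_(x in `]0%R, 1%R[) (x `^ (s - 1))%:E)%E).
    apply: ge0_le_integral => //.
    + by move=> x _; rewrite lee_fin mulr_ge0 ?powR_ge0 ?expR_ge0.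
    + by apply: mG.
    + apply/measurable_EFinP; apply: measurable_funTS.
      exact: measurable_powR.
    + move=> x /=; rewrite in_itv/= => /andP[x0 x1].
      by rewrite lee_fin ler_piMr ?powR_ge0// expR_le1 oppr_le0 ltW.
  apply: le_lt_trans (ltry (s^-1 - 0)).
  apply: (@integral_itvoo_le_primitive R _ (fun x => s^-1 * x `^ s))
    => // x /andP[x0 x1].
  + exact: powR_ge0.
  + apply/differentiable_continuous/derivable1_diffP/derivable_powR.
    by rewrite in_itv/= x0.
  + have -> : x `^ (s - 1) = s^-1 *: (s * x `^ (s - 1)).
      by rewrite /GRing.scale/= mulKf// gt_eqF.
    exact: (@is_deriveZ _ _ _ (@powR R ^~ s) s^-1 x 1 _ (is_derive1_powR s x0)).
  + have si : 0 <= s^-1 by rewrite invr_ge0 ltW.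
    rewrite mulr_ge0 ?powR_ge0//= ler_piMr//.
    have -> : 1 = 1 `^ s :> R by rewrite powR1.
    by apply: ge0_ler_powR; rewrite ?nnegrE ?ltW.
- apply: (@le_lt_trans _ _
    (\int[lebesgue_measure]_(x in `[1%R, +oo[) (expR (- x))%:E)%E).
    apply: ge0_le_integral => //.
    + by move=> x _; rewrite lee_fin mulr_ge0 ?powR_ge0 ?expR_ge0.
    + by apply: mG.
    + apply/measurable_EFinP; apply: measurable_funTS.
      by apply: measurableT_comp => //; exact: oppr_measurable.
    + move=> x /=; rewrite in_itv/= andbT => x1.
      rewrite lee_fin ler_piMl ?expR_ge0//.
      rewrite -[leRHS](powRr0 x); apply: ler_powR => //; lra.
  by rewrite integral_expRN_1y ltry.
Qed.

(** Finiteness matters here as well as positivity of the integrand: [Gamma] is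
    defined through [fine], which sends an infinite integral to 0. *)
Lemma Gamma_gt0 {R : realType} (s : R) : 0 < s -> s <= 1 -> 0 < Gamma s.
Proof.
move=> s0 s1; rewrite /Gamma /Rintegral fine_gt0// Gamma_integral_lty// andbT.
have G0 (x : R) : (0 <= (x `^ (s - 1) * expR (- x))%:E)%E.
  by rewrite lee_fin mulr_ge0 ?powR_ge0 ?expR_ge0.
have mG D := measurable_Gamma_integrand D s.
(* On ]0, 1] the integrand is at least [expR (-1)]. *)
pose c : R := expR (-1).
have c0 : 0 < c by exact: expR_gt0.
apply: (@lt_le_trans _ _
  (\int[lebesgue_measure]_(x in `]0%R, 1%R]) (cst c%:E x))%E).
  rewrite integral_cst//= lebesgue_measure_itv/= lte_fin ltr01.
  by rewrite -EFinB -EFinM lte_fin subr0 mulr1.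
apply: (@le_trans _ _
  (\int[lebesgue_measure]_(x in `]0%R, 1%R]) (x `^ (s - 1) * expR (- x))%:E)%E).
  apply: ge0_le_integral => //.
  - by move=> x _; rewrite lee_fin ltW.
  - by apply: mG.
  move=> x /=; rewrite in_itv/= => /andP[x0 x1]; rewrite lee_fin.
  rewrite -[c]mul1r; apply: ler_pM => //; rewrite ?expR_ge0//; last first.
    by rewrite ler_expR lerN2.
  rewrite -[leLHS](powRr0 x); apply: ger_powR; rewrite ?x0//; lra.
apply: ge0_subset_integral => //; first by apply: mG.
by move=> x /=; rewrite !in_itv/= andbT => /andP[].
Qed.

(** * The truncated kernel *)

Lemma is_derive_powR_subl {R : realType} (c t a x : R) : x < t ->
  is_derive x 1 (fun y => c * (t - y) `^ a) (- (c * (a * (t - x) `^ (a - 1)))).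
Proof.
move=> xt; have tx : 0 < t - x by rewrite subr_gt0.
have h1 : is_derive x 1 (fun y : R => t - y) (-1).
  have -> : -1 = 0 - 1 :> R by rewrite sub0r.
  exact: (@is_deriveB _ _ _ (cst t) id x 1 0 1).
have h2 := @is_derive1_comp R (@powR R ^~ a) (fun y => t - y) x _ _
  (is_derive1_powR a tx) h1.
have := @is_deriveZ _ _ _ ((@powR R ^~ a) \o (fun y => t - y)) c x 1 _ h2.
by rewrite mulrN1 scalerN.
Qed.

Lemma continuous_powR_subl {R : realType} (c t a x : R) : x < t ->
  {for x, continuous (fun y => c * (t - y) `^ a)}.
Proof.
move=> xt; apply/differentiable_continuous/derivable1_diffP.
by have [] := is_derive_powR_subl c t a x xt.
Qed.

Lemma measurable_powR_subl {R : realType} (D : set R) (t a : R) :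
  measurable_fun D (fun y : R => (t - y) `^ a).
Proof.
apply: measurable_funTS.
apply: (@measurableT_comp _ _ _ _ _ _ (@powR R ^~ a)); first exact: measurable_powR.
by apply: measurable_funB.
Qed.

(** The kernel [(t - x) `^ (- (1 + alpha))] of the Marchaud derivative, weighted
    by [min 1 ((t - x) / L)], which bounds the increment between [x] and [t] of
    any nondecreasing function with values in [[0, 1]] and Lipschitz constant
    [L^-1]. *)
Definition truncated_kernel {R : realType} (alpha t L x : R) : R :=
  Num.min 1 ((t - x) / L) / (t - x) `^ (1 + alpha).

Lemma truncated_kernel_ge0 {R : realType} (alpha t L x : R) :
  0 < L -> x < t -> 0 <= truncated_kernel alpha t L x.
Proof.
move=> L0 xt; rewrite divr_ge0 ?powR_ge0// le_min ler01 divr_ge0 ?ltW//.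
by rewrite subr_gt0.
Qed.

Lemma measurable_truncated_kernel {R : realType} (D : set R) (alpha t L : R) :
  measurable_fun D (truncated_kernel alpha t L).
Proof.
have -> : truncated_kernel alpha t L =
    (fun x => Num.min 1 ((t - x) / L) * (t - x) `^ (- (1 + alpha))).
  by apply/funext => x; rewrite powRN.
apply: measurable_funM; last exact: measurable_powR_subl.
apply: measurable_minr => //; apply: measurable_funM => //.
by apply: measurable_funTS; exact: measurable_funB.
Qed.

(** The first summand of the constant comes from [x < t - L], where the weight
    is bounded by 1, and the second from [t - L < x < t], where it is bounded
    by [(t - x) / L] and lowers the order of the singularity to [alpha < 1]. *)
Lemma integral_truncated_kernel_le {R : realType} (alpha t L : R) :
  0 < alpha -> alpha < 1 -> 0 < L ->
  (\int[lebesgue_measure]_(x in `]-oo, t[)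
     (truncated_kernel alpha t L x)%:E
   <= ((alpha^-1 + (1 - alpha)^-1) * L `^ (- alpha))%:E)%E.
Proof.
move=> a0 a1 L0.
pose k := truncated_kernel alpha t L.
have k0 x : x < t -> 0 <= k x by move=> xt; exact: truncated_kernel_ge0.
have mk D : measurable_fun D (fun x => (k x)%:E).
  by apply/measurable_EFinP; exact: measurable_truncated_kernel.
rewrite (@itv_bndbnd_setU _ _ _ (BLeft (t - L))) ?bnd_simp//; last by lra.
rewrite ge0_integral_setU//=; last 3 first.
- by apply: mk.
- move=> x [] /=; rewrite in_itv/= => h; apply: k0; first by lra.
  by case/andP: h.
- rewrite disj_set2E; apply/eqP/seteqP; split=> // x [] /=.
  by rewrite !in_itv/= => h /andP[h' _]; lra.
rewrite mulrDl EFinD; apply: leeD.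
- apply: (@le_trans _ _ (\int[lebesgue_measure]_(x in `]-oo, (t - L)%R[)
     (1 * (t - x) `^ (- (1 + alpha)))%:E)%E).
    apply: ge0_le_integral => //.
    + by move=> x /=; rewrite in_itv/= => h; rewrite lee_fin k0//; lra.
    + by apply: mk.
    + apply/measurable_EFinP; apply: measurable_funM => //.
      exact: measurable_powR_subl.
    + move=> x /= _; rewrite lee_fin mul1r powRN -[leRHS]mul1r.
      rewrite ler_wpM2r ?invr_ge0 ?powR_ge0//.
      by rewrite ge_min lexx.
  rewrite -[X in (_ <= X%:E)%E]subr0.
  apply: (@integral_itvNyo_le_primitive R _
    (fun y => alpha^-1 * (t - y) `^ (- alpha))) => x xt.
  + by rewrite mul1r powR_ge0.
  + by apply: continuous_powR_subl; lra.
  + have -> : 1 * (t - x) `^ (- (1 + alpha)) =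
        - (alpha^-1 * (- alpha * (t - x) `^ (- alpha - 1))).
      rewrite mulNr mulrN opprK mulKf ?gt_eqF// mul1r; congr (_ `^ _); ring.
    by apply: is_derive_powR_subl; lra.
  + apply/andP; split; first by rewrite mulr_ge0 ?powR_ge0// invr_ge0 ltW.
    rewrite ler_pM2l ?invr_gt0//.
    rewrite !powRN lef_pV2 ?posrE ?powR_gt0//; last by lra.
    by apply: ge0_ler_powR; rewrite ?nnegrE; lra.
- rewrite -(integral_itv_obnd_cbnd (mk _)).
  apply: (@le_trans _ _ (\int[lebesgue_measure]_(x in `](t - L)%R, t[)
     (L^-1 * (t - x) `^ (- alpha))%:E)%E).
    apply: ge0_le_integral => //.
    + by move=> x /=; rewrite in_itv/= => /andP[_ h]; rewrite lee_fin k0.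
    + by apply: mk.
    + apply/measurable_EFinP; apply: measurable_funM => //.
      exact: measurable_powR_subl.
    + move=> x /=; rewrite in_itv/= => /andP[h1 h2]; rewrite lee_fin.
      have tx : 0 < t - x by lra.
      have -> : L^-1 * (t - x) `^ (- alpha) = (t - x) / L / (t - x) `^ (1 + alpha).
        rewrite -powRN opprD powRD; last by rewrite (gt_eqF tx) implybT.
        rewrite powR_inv1 ?(ltW tx)//; field.
        by rewrite !gt_eqF.
      rewrite /k /truncated_kernel; apply: ler_wpM2r.
        by rewrite invr_ge0 powR_ge0.
      by rewrite ge_min lexx orbT.
  rewrite -[X in (_ <= X%:E)%E]add0r -[X in (_ <= (_ + X)%:E)%E]opprK.
  have b0 : 0 < (1 - alpha)^-1 by rewrite invr_gt0; lra.
  apply: (@integral_itvoo_le_primitive R _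
    (fun y => - (L^-1 * (1 - alpha)^-1) * (t - y) `^ (1 - alpha))); first by lra.
  + by move=> x xt; rewrite mulr_ge0 ?powR_ge0// invr_ge0 ltW.
  + by move=> x xt; apply: continuous_powR_subl; lra.
  + move=> x xt.
    have -> : L^-1 * (t - x) `^ (- alpha) =
        - (- (L^-1 * (1 - alpha)^-1) * ((1 - alpha) * (t - x) `^ (1 - alpha - 1))).
      have -> : 1 - alpha - 1 = - alpha by ring.
      by field; rewrite (gt_eqF L0) /= gt_eqF// -invr_gt0.
    by apply: is_derive_powR_subl; lra.
  + move=> x xt; apply/andP; split; last first.
      by rewrite mulNr oppr_le0 !mulr_ge0 ?powR_ge0 ?invr_ge0//; lra.
    rewrite mulNr lerN2.
    have -> : (1 - alpha)^-1 * L `^ (- alpha) =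
        L^-1 * (1 - alpha)^-1 * L `^ (1 - alpha).
      rewrite powRD; last by rewrite (gt_eqF L0) implybT.
      rewrite powRr1 ?(ltW L0)//; field.
      by rewrite (gt_eqF L0) /= gt_eqF// -invr_gt0.
    rewrite ler_pM2l ?mulr_gt0 ?invr_gt0//; last by lra.
    by apply: ge0_ler_powR; rewrite ?nnegrE; lra.
Qed.

(** * Solutions of the homogeneous equation *)

Lemma integral_eq0_integrable {d} {T : measurableType d} {R : realType}
    (mu : {measure set T -> \bar R}) (D : set T) (f : T -> \bar R) :
  measurable D -> measurable_fun D f -> (\int[mu]_(x in D) f x = 0)%E ->
  mu.-integrable D f.
Proof.
move=> mD mf; rewrite integralE => int0; apply/integrableP; split=> //.
have p0 : (0 <= \int[mu]_(x in D) f^\+ x)%E by apply: integral_ge0.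
have n0 : (0 <= \int[mu]_(x in D) f^\- x)%E by apply: integral_ge0.
have -> : (\int[mu]_(x in D) `|f x|
    = \int[mu]_(x in D) f^\+ x + \int[mu]_(x in D) f^\- x)%E.
  rewrite -ge0_integralD//; [|exact: measurable_funepos|exact: measurable_funeneg].
  by apply: eq_integral => x _; rewrite -/((abse \o f) x) fune_abse.
move: int0 p0 n0.
case: (\int[mu]_(x in D) f^\+ x)%E => [p| |];
  case: (\int[mu]_(x in D) f^\- x)%E => // q _ _ _.
by rewrite -EFinD ltry.
Qed.

(** [v] solves the homogeneous equation without its normalizing factor: at
    every [t] the defining integral converges absolutely and vanishes. *)
Definition marchaud_null {R : realType} (alpha : R) (v : R -> R) : Prop :=
  forall t, let f := fun x => ((v t - v x) / (t - x) `^ (1 + alpha))%:E in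
    lebesgue_measure.-integrable `]-oo, t[ f /\
    (\int[lebesgue_measure]_(x in `]-oo, t[) f x = 0)%E.

Lemma marchaud_eq0_null {R : realType} (alpha : R) (u : R -> R) :
  0 < alpha -> alpha < 1 -> continuous u ->
  (forall t, marchaud alpha u t = 0%E) -> marchaud_null alpha u.
Proof.
move=> a0 a1 cu u0 t f.
have int0 : (\int[lebesgue_measure]_(x in `]-oo, t[) f x = 0)%E.
  have /eqP := u0 t; rewrite /marchaud mule_eq0 => /orP[|/eqP//].
  rewrite eqe /marchaud_const mulf_eq0 invr_eq0 (gt_eqF a0)/= gt_eqF//.
  by apply: Gamma_gt0; lra.
split=> //; apply: integral_eq0_integrable => //.
have mf : measurable_fun `]-oo, t[ (fun x : R => (u t - u x) / (t - x) `^ (1 + alpha)).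
  have -> : (fun x => (u t - u x) / (t - x) `^ (1 + alpha)) =
      (fun x => (u t - u x) * (t - x) `^ (- (1 + alpha))).
    by apply/funext => x; rewrite powRN.
  apply: measurable_funM; last exact: measurable_powR_subl.
  apply: measurable_funB => //.
  by apply: measurable_funTS; exact: continuous_measurable_fun.
exact/measurable_EFinP.
Qed.

Lemma marchaud_null_subr {R : realType} (alpha m : R) (u : R -> R) :
  marchaud_null alpha u -> marchaud_null alpha (fun x => u x - m).
Proof.
move=> nu t; have [] := nu t.
have -> // : (fun x => ((u t - u x) / (t - x) `^ (1 + alpha))%:E) =
  (fun x => ((u t - m - (u x - m)) / (t - x) `^ (1 + alpha))%:E).
apply/funext => x; congr ((_ / _)%:E); ring.
Qed.

Lemma marchaud_null_subl {R : realType} (alpha M : R) (u : R -> R) :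
  marchaud_null alpha u -> marchaud_null alpha (fun x => M - u x).
Proof.
move=> nu t; have [iu u0] := nu t.
have -> : (fun x => ((M - u t - (M - u x)) / (t - x) `^ (1 + alpha))%:E) =
  (fun x => ((-1)%:E * ((u t - u x) / (t - x) `^ (1 + alpha))%:E)%E).
  by apply/funext => x; rewrite -EFinM; congr (_%:E); ring.
split; first exact: integrableZl.
by rewrite integralZl// u0 mule0.
Qed.

(** * The growth estimate *)

(** The comparison function: 0 up to [a], linear on [[a, a + L]], and 1 from
    [a + L] on. *)
Definition ramp {R : realType} (a L x : R) : R :=
  Num.min 1 (Num.max 0 ((x - a) / L)).

Lemma ramp_eq0 {R : realType} (a L x : R) : 0 < L -> x <= a -> ramp a L x = 0.
Proof.
move=> L0 xa; rewrite /ramp max_l ?min_r//.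
by rewrite ler_pdivrMr// mul0r subr_le0.
Qed.

Lemma ramp_eq1 {R : realType} (a L x : R) :
  0 < L -> a + L <= x -> ramp a L x = 1.
Proof.
move=> L0 ax; rewrite /ramp min_l// le_max; apply/orP; right.
by rewrite ler_pdivlMr// mul1r; lra.
Qed.

Lemma ramp_increment {R : realType} (a L x y : R) : 0 < L -> x <= y ->
  ramp a L y - ramp a L x <= Num.min 1 ((y - x) / L).
Proof.
move=> L0 xy; rewrite /ramp.
have -> : (y - x) / L = (y - a) / L - (x - a) / L.
  by rewrite -mulrBl; congr (_ / _); ring.
have : (x - a) / L <= (y - a) / L by rewrite ler_pM2r ?invr_gt0//; lra.
move: ((x - a) / L) ((y - a) / L) => p q pq.
by rewrite !minEle !maxEle; repeat case: ifPn; rewrite -?ltNge; lra.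
Qed.

Lemma continuous_ramp {R : realType} (a L : R) : continuous (ramp a L).
Proof.
move=> x.
have c0 (b : R) : {for x, continuous (cst b)} by exact: cst_continuous.
have cl : {for x, continuous (fun y => (y - a) / L)}.
  apply: continuousM; last exact: c0.
  by apply: continuousB; [exact: cvg_id|exact: c0].
exact: (continuous_min (c0 1) (continuous_max (c0 0) cl)).
Qed.

(** A nonnegative solution with mean at least [D / 2] over [[a - L, a]] is at
    least [c * D] on [[a + L, a + 2 * L]], with [c] depending only on
    [alpha]. *)
Lemma marchaud_null_growth {R : realType} (alpha : R) :
  0 < alpha -> alpha < 1 ->
  exists2 c, 0 < c & forall (v : R -> R) (a L D : R),
    0 < L -> 0 < D -> continuous v -> (forall x, 0 <= v x) ->
    marchaud_null alpha v ->
    ((L * D / 2)%:E <= \int[lebesgue_measure]_(x in `[(a - L)%R, a]) (v x)%:E)%E ->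
    forall t, a + L <= t <= a + 2 * L -> c * D <= v t.
Proof.
move=> al0 al1.
pose C : R := alpha^-1 + (1 - alpha)^-1.
have C0 : 0 < C by rewrite addr_gt0 ?invr_gt0//; lra.
pose p3 : R := 3 `^ (- (1 + alpha)).
have p30 : 0 < p3 by rewrite powR_gt0.
(* Any [c < p3 / (2 * C)] makes the final comparison of integrals fail. *)
exists (p3 / (4 * C)); first by rewrite divr_gt0// mulr_gt0.
move=> v a L D L0 D0 cv v0 vnull intv t /andP[t1 t2].
set h := _ * D.
have h0 : 0 < h by rewrite mulr_gt0// divr_gt0// mulr_gt0.
rewrite leNgt; apply/negP => vth.
pose w x := v x - h * ramp a L x.
have cw : continuous w.
  move=> x; have ch : {for x, continuous (cst h : R -> R)} by exact: cst_continuous.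
  exact: (continuousB (cv x) (continuousM ch (@continuous_ramp _ a L x))).
have aL : a <= a + 2 * L by lra.
have [t0 t0I wmin] := EVT_min aL (continuous_subspaceT cw).
have wt0 : w t0 < 0.
  apply: (@le_lt_trans _ _ (w t)); first by apply: wmin; rewrite in_itv/=; lra.
  by rewrite /w ramp_eq1// mulr1 subr_lt0.
move: t0I; rewrite in_itv/= => /andP[at0 t02].
have {}at0 : a < t0.
  rewrite lt_neqAle at0 andbT; apply/eqP => E; move: wt0.
  by rewrite /w ramp_eq0 -?E// mulr0 subr0 ltNge v0.
(* The minimum at [t0] is a minimum over the whole past of [t0]. *)
have wpast x : x < t0 -> w t0 <= w x.
  move=> xt0; have [xa|ax] := leP x a; last by apply: wmin; rewrite in_itv/=; lra.
  by rewrite (le_trans (ltW wt0))// /w ramp_eq0// mulr0 subr0.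
have [] := vnull t0.
set f := fun x : R => _; move=> fint f0.
pose k := truncated_kernel alpha t0 L.
have kle := integral_truncated_kernel_le alpha t0 L al0 al1 L0.
have k0 x : x < t0 -> 0 <= k x by move=> xt; exact: truncated_kernel_ge0.
have mk D' : measurable_fun D' k by exact: measurable_truncated_kernel.
have kint : lebesgue_measure.-integrable `]-oo, t0[ (fun x => (k x)%:E).
  apply/integrableP; split; first by apply/measurable_EFinP; exact: mk.
  apply: le_lt_trans (ltry (C * L `^ (- alpha))); apply: le_trans kle.
  apply: ge0_le_integral => //.
  - by apply: measurableT_comp => //; apply/measurable_EFinP; exact: mk.
  - by apply/measurable_EFinP; exact: mk.
  - move=> x /=; rewrite in_itv/= => xt.
    by rewrite /= lee_fin ger0_norm// k0.
pose q := (3 * L) `^ (- (1 + alpha)).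
have q0 : 0 < q by rewrite powR_gt0// mulr_gt0.
(* By minimality [g] is nonnegative, and its integral over the past of [t0]
   is [h] times that of [k], since [v] is a solution. On [[a - L, a]] the ramp
   vanishes and the distance to [t0] is at most [3 * L], so [g] dominates
   [q * v] there. *)
pose g x := h * k x - (v t0 - v x) / (t0 - x) `^ (1 + alpha).
have gE x : g x = (h * Num.min 1 ((t0 - x) / L) - v t0 + v x) / (t0 - x) `^ (1 + alpha).
  by rewrite /g /k /truncated_kernel; ring.
have g0 x : x < t0 -> 0 <= g x.
  move=> xt; rewrite gE divr_ge0 ?powR_ge0//.
  have := wpast x xt; rewrite /w.
  have := @ramp_increment _ a L _ _ L0 (ltW xt).
  rewrite -(ler_pM2l h0) mulrBr; lra.
have gJ (x : R) : a - L <= x <= a -> q * v x <= g x.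
  move=> /andP[x1 x2]; rewrite gE mulrC; apply: ler_pM => //.
  - exact: ltW.
  - have := @ramp_increment _ a L x t0 L0; rewrite (@ramp_eq0 _ a L x)// subr0.
    move=> /(_ (ltW (le_lt_trans x2 at0)))/(ler_wpM2l (ltW h0)).
    by move: wt0; rewrite /w; lra.
  - have tx : 0 < t0 - x by rewrite subr_gt0 (le_lt_trans x2).
    rewrite /q powRN lef_pV2 ?posrE ?powR_gt0 ?mulr_gt0//.
    by apply: ge0_ler_powR; rewrite ?nnegrE; lra.
have intg : (\int[lebesgue_measure]_(x in `]-oo, t0[) (g x)%:E =
    h%:E * \int[lebesgue_measure]_(x in `]-oo, t0[) (k x)%:E)%E.
  under eq_integral do rewrite EFinB EFinM.
  rewrite integralB//; last exact: integrableZl.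
  by rewrite integralZl// f0 sube0.
have mg D' : D' `<=` `]-oo, t0[%classic -> measurable_fun D' (fun x => (g x)%:E).
  move=> D't; apply: (@measurable_funS _ _ _ _ `]-oo, t0[%classic) => //.
  have [mf _] := integrableP _ _ _ fint.
  apply/measurable_EFinP; apply: measurable_funB; last exact/measurable_EFinP.
  by apply: measurable_funM.
have JI : `[(a - L)%R, a%R]%classic `<=` (`]-oo, t0[%classic : set R).
  by move=> x /=; rewrite !in_itv/= => /andP[_ ?]; lra.
have main : ((q * (L * D / 2))%:E <= (h * (C * L `^ (- alpha)))%:E)%E.
  apply: (@le_trans _ _
    (q%:E * \int[lebesgue_measure]_(x in `[(a - L)%R, a]) (v x)%:E)%E).
    by rewrite EFinM lee_pmul2l// lte_fin.
  apply: (@le_trans _ _ (\int[lebesgue_measure]_(x in `[(a - L)%R, a]) (g x)%:E)%E).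
    have mv : measurable_fun (`[(a - L)%R, a]%classic : set R) v.
      by apply: measurable_funTS; exact: continuous_measurable_fun.
    rewrite -ge0_integralZl//; last 3 first.
    - exact/measurable_EFinP.
    - by move=> x _; rewrite lee_fin.
    - by rewrite lee_fin ltW.
    apply: ge0_le_integral => //.
    - by move=> x _; rewrite -EFinM lee_fin mulr_ge0 // ltW.
    - by apply/measurable_EFinP; apply: measurable_funM.
    - exact: mg.
  apply: (@le_trans _ _ (\int[lebesgue_measure]_(x in `]-oo, t0[) (g x)%:E)%E).
    apply: ge0_subset_integral => //; first exact: mg.
  by rewrite intg (EFinM h); apply: lee_wpmul2l => //; rewrite lee_fin ltW.
have hC : h * C = p3 * D / 4 by rewrite /h; field; rewrite gt_eqF.
have qL : q * L = p3 * L `^ (- alpha).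
  rewrite /q /p3 powRM ?(ltW L0)// -mulrA; congr (_ * _).
  rewrite opprD addrC powRD; last by rewrite (gt_eqF L0) implybT.
  by rewrite powR_inv1 ?(ltW L0)// mulfVK// gt_eqF.
move: main; rewrite lee_fin !mulrA qL hC.
have : 0 < p3 * L `^ (- alpha) * D by rewrite !mulr_gt0// powR_gt0.
lra.
Qed.

(** * Oscillation decay and the Liouville theorem *)

Lemma marchaud_null_osc_decay {R : realType} (alpha : R) :
  0 < alpha -> alpha < 1 ->
  exists2 c, 0 < c & forall (u : R -> R) (m M : R),
    m < M -> continuous u -> (forall x, m <= u x <= M) ->
    marchaud_null alpha u ->
    forall x y, u x - u y <= (1 - c) * (M - m).
Proof.
move=> al0 al1; have [c c0 growth] := @marchaud_null_growth _ alpha al0 al1.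
exists c => // u m M mM cu umM nu x y.
have D0 : 0 < M - m by lra.
have um z : 0 <= u z - m by rewrite subr_ge0; have /andP[] := umM z.
have uM z : 0 <= M - u z by rewrite subr_ge0; have /andP[] := umM z.
(* [a] and [L] are chosen so that [x] and [y] both lie in
   [[a + L, a + 2 * L]]. *)
pose L := `|x - y| + 1.
have xyL : `|x - y| < L by rewrite ltrDl.
have L0 : 0 < L by rewrite (le_lt_trans _ xyL).
pose a := Num.min x y - L.
have [xI yI] : a + L <= x <= a + 2 * L /\ a + L <= y <= a + 2 * L.
  move: xyL; rewrite /a ltr_norml => /andP[].
  by rewrite minEle; case: ifPn; rewrite -?ltNge => *; split; lra.
pose J : set R := `[a - L, a]%classic.
have cm : continuous (fun z => u z - m).
  by move=> z; apply: (continuousB (cu z)); exact: cst_continuous.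
have cM : continuous (fun z => M - u z).
  by move=> z; apply: (fun h => continuousB h (cu z)); exact: cst_continuous.
have [low|/ltW high] := leP (L * (M - m) / 2)%:E
    (\int[lebesgue_measure]_(z in J) (u z - m)%:E)%E.
  have g := growth _ a L (M - m) L0 D0 cm um (marchaud_null_subr alpha m u nu) low.
  by have := g y yI; have := uM x; lra.
suff low : ((L * (M - m) / 2)%:E <=
    \int[lebesgue_measure]_(z in J) (M - u z)%:E)%E.
  have g := growth _ a L (M - m) L0 D0 cM uM (marchaud_null_subl alpha M u nu) low.
  by have := g x xI; have := um y; lra.
have : (\int[lebesgue_measure]_(z in J) (u z - m)%:E
    + \int[lebesgue_measure]_(z in J) (M - u z)%:E = (L * (M - m))%:E)%E.
  have mJ0 : measurable J by exact: measurable_itv.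
  have mJ (f : R -> R) : continuous f -> measurable_fun J (fun z : R => (f z)%:E).
    move=> cf; apply/measurable_EFinP.
    by apply: measurable_funTS; exact: continuous_measurable_fun.
  rewrite -ge0_integralD//; last 4 first.
  - by move=> z _; rewrite lee_fin.
  - exact: mJ.
  - by move=> z _; rewrite lee_fin.
  - exact: mJ.
  transitivity (\int[lebesgue_measure]_(z in J) (cst (M - m)%:E z))%E.
    by apply: eq_integral => z _; rewrite -EFinD /cst; congr (_%:E); ring.
  rewrite /J integral_cst//= lebesgue_measure_itv/= lte_fin.
  have -> : a - L < a by lra.
  by rewrite -EFinB -EFinM; congr (_%:E); ring.
move: high.
case: (\int[lebesgue_measure]_(z in J) (u z - m)%:E)%E => [A| |] //;
  case: (\int[lebesgue_measure]_(z in J) (M - u z)%:E)%E => [B| |] //.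
by rewrite -EFinD !lee_fin => h [e]; lra.
Qed.

Theorem theorem1p4 (R : realType) (alpha : R) (u : R -> R)
  (alpha_gt0 : 0 < alpha) (alpha_lt1 : alpha < 1)
  (u_C1 : C1 u) (u_bounded : bounded_fun u)
  (u_sol : forall t : R, marchaud alpha u t = 0%E) :
  exists c : R, forall t : R, u t = c.
Proof.
have cu : continuous u.
  by move=> x; apply/differentiable_continuous/derivable1_diffP; exact: u_C1.1.
have nu := marchaud_eq0_null alpha u alpha_gt0 alpha_lt1 cu u_sol.
pose M := sup (range u); pose m := inf (range u).
have umM x : m <= u x <= M.
  apply/andP; split.
  - by apply: ge_inf; [exact: bounded_fun_has_lbound|exists x].
  - by apply: ub_le_sup; [exact: bounded_fun_has_ubound|exists x].
have [Mm|mM] := leP M m.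
  exists m => t; have := umM t => /andP[h1 h2].
  by apply/eqP; rewrite eq_le h1 (le_trans h2).
have [c c0 /(_ u m M mM cu umM nu) osc] :=
  marchaud_null_osc_decay alpha alpha_gt0 alpha_lt1.
have ne : range u !=set0 by exists (u 0), 0.
have : M <= m + (1 - c) * (M - m).
  apply: ge_sup => // _ [x _ <-]; rewrite -lerBlDr.
  by apply: lb_le_inf => // _ [y _ <-]; have := osc x y; lra.
have : 0 < c * (M - m) by rewrite mulr_gt0// subr_gt0.
lra.
Qed.
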